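(* $\mathbb{E}^2\not\to(\ell_2,\ell_{6330})$. That is, there is a coloring of the points of the Euclidean plane with the two colors red and blue such that there is no pair of red points at distance $1$, and no all-blue congruent copy of $\ell_{6330}$ (a set of $6330$ collinear points with consecutive points at distance $1$).
   Context: $\mathbb{E}^n$ denotes $\mathbb{R}^n$ with the Euclidean norm. $\ell_m$ denotes a collection of $m$ points on a line with consecutive points at distance $1$. We write $\mathbb{E}^n\not\to(S_1,S_2)$ if there is a two-coloring of $\mathbb{E}^n$ (colors red and blue) with no all-red congruent copy of $S_1$ and no all-blue congruent copy of $S_2$. *)

(* Defs.v *)
From mathcomp Require Import all_boot all_order all_algebra.
From mathcomp Require Import classical_sets reals.

Set Implicit Arguments.
Unset Strict Implicit.
Unset Printing Implicit Defensive.

Import Order.TTheory GRing.Theory Num.Theory.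
Local Open Scope ring_scope.
Local Open Scope classical_set_scope.

Inductive color := Red | Blue.

Section EuclideanRamsey.
Variables (R : realType) (n : nat).
Implicit Types (x y : 'rV[R]_n) (S T : set 'rV[R]_n).

(* The library's own norm on 'rV[R]_n is the sup norm, hence this definition. *)
Definition edist x y : R := Num.sqrt (\sum_(i < n) (x 0 i - y 0 i) ^+ 2).

Definition isometry (f : 'rV[R]_n -> 'rV[R]_n) : Prop :=
  forall x y, edist (f x) (f y) = edist x y.

Definition congruent S T : Prop := exists2 f, isometry f & T = f @` S.

Definition monochromatic (c : 'rV[R]_n -> color) (k : color) T : Prop :=
  forall x, T x -> c x = k.

Definition not_arrow (S1 S2 : set 'rV[R]_n) : Prop :=
  exists c : 'rV[R]_n -> color,
    (forall T, congruent S1 T -> ~ monochromatic c Red T) /\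
    (forall T, congruent S2 T -> ~ monochromatic c Blue T).

End EuclideanRamsey.

(* The points 0, 1, ..., m - 1 of the first coordinate axis; the choice of line
   and origin is immaterial, as only congruent copies are considered. *)
Definition ell (R : realType) (n m : nat) : set 'rV[R]_n.+1 :=
  [set i%:R *: delta_mx 0 ord0 | i in [set i : nat | (i < m)%N]].

(* Main.v *)
Require Import Defs.
From mathcomp Require Import all_boot all_order all_algebra.
From mathcomp Require Import classical_sets reals.
From mathcomp Require Import boolp lra ring zify.
From Stdlib Require ZArith.

Set Implicit Arguments.
Unset Strict Implicit.
Unset Printing Implicit Defensive.

Import Order.TTheory GRing.Theory Num.Theory.
Local Open Scope ring_scope.

(** Place the points (8a, 14t), a and t of equal parity, in the plane: they form
a nearly regular triangular lattice. Around each of them put a hexagonal tile,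
slightly smaller than a hexagonal fundamental domain, so that distinct tiles
are more than 1 apart. Inside a tile, cut the plane into square cells of side
3/5 and colour red the cells whose two coordinates have prescribed residues
modulo 3, the phase of the tile; two such cells are more than 1 apart, and a
cell has diameter less than 1. So, whatever the phases, no two red points are at
distance 1 ([red_no_unit]). The phases are chosen periodically, a tile being
indexed by (a, t) modulo 800.

Hexagonal tiles are used because no line can slip between them for long. In the
direction, among the three of the lattice, along which a progression advances
fastest, any three consecutive columns of tiles contain a tile in which two
consecutive terms of the progression lie ([column_hit]). The cells of these two
terms have different residues ([phase_step]). Hence 6330 terms visit 210 tiles,
pairwise distinct even up to the period, each of which has 2 of its 9 phases
that make some term red; moreover this survives a perturbation of the
progression by 1/20 provided that the red cells are fattened by 1/20 and the
tiles slightly enlarged ([robust_hits]).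

So a proportion of at most (7/9)^210 of all choices of phases fails for a given
progression. Up to the period and to a perturbation of 1/20, progressions are
described by their starting point modulo the period and their step, both
rounded; there are fewer than (9/7)^210 possibilities ([keys_lt_pow]), and so
some choice of phases fails for none of them ([union_bound]). *)

(** * Counting *)

Section Counting.

Variables T V : finType.

(** The k constraints bear on distinct values of f, so that they are
independent: this product formula is what pairwise distinct tiles are for. *)
Lemma card_avoid k d (g : 'I_k -> T) (w : 'I_k -> {set V}) :
  injective g -> (forall j, #|w j| = d) ->
  (#|[set f : {ffun T -> V} | [forall j, f (g j) \notin w j]]| * #|V| ^ k =
   (#|V| - d) ^ k * #|V| ^ #|T|)%N.
Proof.
move=> injg cardw.
pose F t := [set v : V | [forall j, (g j == t) ==> (v \notin w j)]].
have -> : [set f : {ffun T -> V} | [forall j, f (g j) \notin w j]] =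
          [set f | f \in family F].
  apply/setP=> f; rewrite !inE; apply/forallP/familyP => [H t | H j].
    by rewrite inE; apply/forallP=> j; apply/implyP=> /eqP<-.
  by have := H (g j); rewrite inE => /forallP/(_ j); rewrite eqxx.
rewrite cardsE card_family foldrE big_map big_enum /=.
rewrite (bigID [in [set g j | j : 'I_k]]) /=.
rewrite big_imset /=; last by move=> i j _ _; apply: injg.
rewrite (eq_bigr (fun=> (#|V| - d)%N)); last first.
  move=> j _; rewrite -(cardw j) -(cardsC (w j)) addKn.
  apply: eq_card => v; rewrite !inE; apply/forallP/idP => [/(_ j)|vw i].
    by rewrite eqxx.
  by apply/implyP=> /eqP/injg->.
rewrite prod_nat_const card_ord -mulnA; congr (_ * _)%N.
rewrite (eq_bigr (fun=> #|V|)) => [|t tNg]; last first.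
  apply: eq_card => v; rewrite !inE; apply/forallP=> j; apply/implyP=> /eqP gj.
  by move: tNg; rewrite -gj imset_f.
rewrite prod_nat_const -expnD; congr (_ ^ _)%N.
have cardg : #|[set g j | j : 'I_k]| = k.
  by rewrite (card_imset _ injg) card_ord.
by rewrite addnC -[RHS](cardC (mem [set g j | j : 'I_k])) cardg.
Qed.

(** Each e excludes at most a proportion ((#|V| - d) / #|V|)^k of all maps,
which leaves one that is not excluded when there are few e. *)
Lemma union_bound (E : finType) k d (P : E -> {ffun T -> V} -> Prop) :
  (0 < #|V|)%N ->
  (forall e, exists B : {set {ffun T -> V}},
     (#|B| * #|V| ^ k <= (#|V| - d) ^ k * #|V| ^ #|T|)%N /\
     forall f, f \notin B -> P e f) ->
  (#|E| * (#|V| - d) ^ k < #|V| ^ k)%N ->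
  exists f, forall e, P e f.
Proof.
move=> V0 /choice[B HB] lt_k.
have [f fB|noB] := pickP [pred f | f \notin \bigcup_e B e].
  exists f => e; apply: (HB e).2; apply: contra fB => fe.
  by apply/bigcupP; exists e.
suff : (#|V| ^ #|T| * #|V| ^ k <= #|E| * (#|V| - d) ^ k * #|V| ^ #|T|)%N.
  by rewrite [leqRHS]mulnC leq_pmul2l ?expn_gt0 ?V0// leqNgt lt_k.
have cardB : #|\bigcup_e B e| = (#|V| ^ #|T|)%N.
  rewrite -card_ffun; apply: eq_card => f; rewrite [RHS]inE.
  by move: (noB f) => /= /negbFE.
rewrite -{1}cardB -mulnA -[leqRHS]sum_nat_const.
apply: (@leq_trans ((\sum_e #|B e|) * #|V| ^ k)).
  rewrite leq_mul2r; apply/orP; right.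
  apply: (big_ind2 (fun (S : {set {ffun T -> V}}) n => #|S| <= n)%N) => //.
    by rewrite cards0.
  by move=> A m A' m' Am Am'; rewrite (leq_trans (leq_card_setU _ _)) ?leq_add.
rewrite big_distrl /= [leqRHS](eq_bigl xpredT)//.
by apply: leq_sum => e _; exact: (HB e).1.
Qed.

End Counting.

(** * The red set *)

Section Pattern.

Variable R : realType.
Implicit Types x y z r u v : R.

(** Up to sign, the three forms are x, -x/2 + 6y/7 and -x/2 - 6y/7, with sum 0;
this is the normalization meant below. The ratio 6/7 is a
rational value just below sqrt 3 / 2, for which they all have norm at most 1;
the lattice points (8a, 14t) are those where their values are 8 times
integers with sum 0 that are congruent modulo 3. *)
Definition hexagon r x y : Prop :=
  [/\ `|x| <= r, `|x / 2 + 6 / 7 * y| <= r & `|x / 2 - 6 / 7 * y| <= r].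

(** The interval between 3k/5 and 3(k+1)/5, extended by 1/20 on both sides to
absorb the perturbation of a progression. *)
Definition fat (k : int) z : Prop :=
  3 / 5 * k%:~R - 1 / 20 <= z <= 3 / 5 * (k%:~R + 1) + 1 / 20.

Definition res n (a : int) : 'I_n.+1 := inord `|(a %% n.+1%:Z)%Z|.

Lemma res_eq n (a b : int) : (res n a == res n b) = (n.+1%:Z %| a - b)%Z.
Proof.
have resE c : (res n c)%:Z = (c %% n.+1%:Z)%Z.
  rewrite /res inordK; first by rewrite gez0_abs// modz_ge0.
  by rewrite -ltz_nat gez0_abs ?modz_ge0// ltz_pmod.
by rewrite -eqz_mod_dvd -!resE eqz_nat.
Qed.

Local Notation phases := {ffun 'I_800 * 'I_800 -> 'I_3 * 'I_3}.

Definition tile_of (a t : int) : 'I_800 * 'I_800 := (res 799 a, res 799 t).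
Definition phase_of (k l : int) : 'I_3 * 'I_3 := (res 2 k, res 2 l).

Definition red (f : phases) x y : Prop :=
  exists a t k l : int,
    [/\ (2 %| a - t)%Z, hexagon (71 / 10) (x - 8 * a%:~R) (y - 14 * t%:~R),
        f (tile_of a t) = phase_of k l,
        fat k (x - 8 * a%:~R) & fat l (y - 14 * t%:~R)].

(** 6400 = 8 * 800 and 11200 = 14 * 800; as 800 is even, adding multiples of it
preserves the parity condition on centres. *)
Lemma red_shift f x y (i j : int) :
  red f x y -> red f (x + 6400 * i%:~R) (y + 11200 * j%:~R).
Proof.
move=> [a [t [k [l [par hex fat_ fx fy]]]]].
exists (a + 800 * i), (t + 800 * j), k, l.
have -> : x + 6400 * i%:~R - 8 * (a + 800 * i)%:~R = x - 8 * a%:~R.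
  by lra.
have -> : y + 11200 * j%:~R - 14 * (t + 800 * j)%:~R = y - 14 * t%:~R.
  by lra.
split=> //; first by lia.
rewrite -fat_; congr (f _).
by congr (_, _); apply/eqP; rewrite res_eq; lia.
Qed.

(** Cauchy-Schwarz inequality in the plane. *)
Lemma linear_form_le1 al be u v :
  al ^+ 2 + be ^+ 2 <= 1 -> u ^+ 2 + v ^+ 2 = 1 -> -1 <= al * u + be * v <= 1.
Proof.
move=> le1 uv1; rewrite -ler_norml -(@ler_pXn2r _ 2) ?nnegrE//.
rewrite real_normK ?num_real// expr1n (le_trans _ le1)//.
rewrite -[leRHS]mulr1 -uv1 -subr_ge0.
suff -> : (al ^+ 2 + be ^+ 2) * (u ^+ 2 + v ^+ 2) - (al * u + be * v) ^+ 2 =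
          (al * v - be * u) ^+ 2 by apply: sqr_ge0.
ring.
Qed.

Lemma unit_forms u v : u ^+ 2 + v ^+ 2 = 1 ->
  [/\ -1 <= u <= 1, -1 <= v <= 1,
      -1 <= u / 2 + 6 / 7 * v <= 1 & -1 <= u / 2 - 6 / 7 * v <= 1].
Proof.
move=> uv1.
have form al be : al ^+ 2 + be ^+ 2 <= 1 -> -1 <= al * u + be * v <= 1.
  by move=> le1; apply: linear_form_le1.
clear uv1; split.
- by have := form 1 0 ltac:(lra); lra.
- by have := form 0 1 ltac:(lra); lra.
- by have := form (1 / 2) (6 / 7) ltac:(lra); lra.
- by have := form (1 / 2) (- (6 / 7)) ltac:(lra); lra.
Qed.

(** A nonzero lattice vector makes one of the three forms at least 16 in
absolute value, which is 1.8 more than twice the radius 7.1 of a tile. *)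
Lemma centers_apart (a t : int) : (2 %| a - t)%Z -> (a, t) != (0, 0) ->
  [|| 2 <= a, a <= -2, 4 <= a + 3 * t, a + 3 * t <= -4,
      4 <= a - 3 * t | a - 3 * t <= -4].
Proof. by rewrite xpair_eqE; lia. Qed.

Lemma hexagons_apart (a t a' t' : int) x y x' y' :
  (2 %| a - t)%Z -> (2 %| a' - t')%Z ->
  hexagon (71 / 10) (x - 8 * a%:~R) (y - 14 * t%:~R) ->
  hexagon (71 / 10) (x' - 8 * a'%:~R) (y' - 14 * t'%:~R) ->
  (x - x') ^+ 2 + (y - y') ^+ 2 = 1 -> a = a' /\ t = t'.
Proof.
move=> par par'; have par2 : (2 %| (a - a') - (t - t'))%Z by lia.
move=> [h1 h2 h3] [h1' h2' h3'] /unit_forms[d1 _ d2 d3].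
have [/eqP|neq] := boolP ((a - a', t - t') == (0, 0)).
  by case=> /subr0_eq-> /subr0_eq->.
rewrite !ler_norml in h1 h2 h3 h1' h2' h3'.
have := centers_apart par2 neq; clear neq par par' par2.
case/or4P => [||| /or3P[||]];
  rewrite -(ler_int R) !(rmorphB, rmorphD, rmorphM) /= => apart; exfalso.
- by move: h1 h1' d1; clear -apart; lra.
- by move: h1 h1' d1; clear -apart; lra.
- by move: h2 h2' d2; clear -apart; lra.
- by move: h2 h2' d2; clear -apart; lra.
- by move: h3 h3' d3; clear -apart; lra.
- by move: h3 h3' d3; clear -apart; lra.
Qed.

(** Extended cells have width 7/10, and 2 * (7/10)^2 < 1; those whose indices
differ by at least 3 leave a gap of 11/10. *)
Lemma fat_apart (k k' : int) z z' : fat k z -> fat k' z' -> -1 <= z - z' <= 1 ->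
  (3 %| k - k')%Z -> k = k' /\ (z - z') ^+ 2 <= 49 / 100.
Proof.
move=> fz fz' d1 dvk.
have [eqk|neqk] := eqVneq k k'.
  split=> //; subst k'; have : -(7 / 10) <= z - z' <= 7 / 10.
    by move: fz fz'; rewrite /fat; clear; lra.
  by clear; move: (z - z') => w /andP[? ?]; nra.
have H : (3 <= k - k') || (k - k' <= -3).
  by move: neqk dvk; clear; lia.
clear neqk dvk; move: fz fz' d1; rewrite /fat => fz fz' d1.
by exfalso; case/orP: H; rewrite -(ler_int R) rmorphB /=; lra.
Qed.

Lemma red_no_unit f x y x' y' : red f x y -> red f x' y' ->
  (x - x') ^+ 2 + (y - y') ^+ 2 <> 1.
Proof.
move=> [a [t [k [l [par hex fk fx fy]]]]].
move=> [a' [t' [k' [l' [par' hex' fk' fx' fy']]]]] dist1.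
have [eqa eqt] := hexagons_apart par par' hex hex' dist1; subst a' t'.
have /eqP := fk; rewrite fk' xpair_eqE !res_eq => /andP[dvk dvl].
have [dx dy _ _] := unit_forms dist1.
have [] := fat_apart fx' fx _ dvk.
  by move: dx; clear; lra.
have [] := fat_apart fy' fy _ dvl.
  by move: dy; clear; lra.
by move: dist1; clear; lra.
Qed.

(** * Progressions meet the tiles *)

(** Follow a line along its fastest direction, the form w, w' being a second
form and th the decrease of w' per unit of w. In terms of r, the value of w' on
column 0, the centres of columns 0, 1, 2 stand at 0, 1 + th, 2 + 2 th modulo
3. The gaps between these are at most 3/2, so r is within 3/4 of one. The unit
is the width 8 of a column. *)
Lemma three_columns r th : 0 <= th <= 1 ->
  exists j m : int, 0 <= j <= 2 /\ `|r - (1 + th) * j%:~R - 3 * m%:~R| <= 3 / 4.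
Proof.
move=> th01; have [n] : exists n : int, 0 <= r - 3 * n%:~R < 3.
  exists (Num.floor (r / 3)).
  have := floor_le (r / 3); have := floorD1_gt (r / 3).
  by rewrite intrD; clear; lra.
set s := r - _ => s03.
have rE : r = s + 3 * n%:~R by rewrite /s; ring.
suff [j [m [j02 mE]]] : exists j m : int, 0 <= j <= 2 /\
    - (3 / 4) <= s - (1 + th) * j%:~R - 3 * m%:~R <= 3 / 4.
  exists j, (n + m); split=> //; rewrite ler_norml.
  by move: mE; rewrite rE intrD; clear; lra.
clearbody s; clear rE r.
(* s is close to the centre at 0, 3, 2 th - 1, 2 th + 2 or 1 + th. *)
have [lt1|ge1] := lerP s (3 / 4); first by exists 0, 0; split=> //; lra.
have [gt2|le2] := lerP (9 / 4) s; first by exists 0, 1; split=> //; lra.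
have [lt3|ge3] := ltrP s (1 / 4 + th).
  by exists 2, (-1); split=> //; rewrite mulrN1z; lra.
have [gt4|le4] := ltrP (7 / 4 + th) s; first by exists 2, 0; split=> //; lra.
by exists 1, 0; split=> //; lra.
Qed.

(** [X] and [Y] are values of two of the three forms at the start, [e] and [d]
their increments. When the line crosses the middle of column a, the two other
forms are, for some a provided by [three_columns], within 8 * 3/4 = 6 of their
values at the centre of a tile; the two terms surrounding the crossing are at
most one step away from it, hence within 7. *)
Lemma column_hit (X Y e d : R) (A : int) : 0 < e <= 1 -> - e <= d <= 0 ->
  exists a m i : int,
    [/\ A <= a <= A + 2, i%:~R * e <= 8 * a%:~R - X < (i%:~R + 1) * e &
     forall n : int, n = i \/ n = i + 1 ->
     [/\ `|X + n%:~R * e - 8 * a%:~R| <= 7,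
         `|Y + n%:~R * d - 8 * (a + 3 * m)%:~R| <= 7 &
         `|X + Y + n%:~R * (e + d) - 8 * (2 * a + 3 * m)%:~R| <= 7]].
Proof.
move=> e01 d01; have e0 : e != 0 by lra.
pose th := - (d / e).
have dE : d = - (th * e) by rewrite /th mulNr divfK// opprK.
have th01 : 0 <= th <= 1.
  rewrite /th -mulNr divr_ge0 ?ler_pdivrMr; lra.
(* tau a is the time, in steps, at which the middle of column a is crossed. *)
pose tau a : R := (8 * a - X) / e.
have tauE a : tau a * e = 8 * a - X by rewrite divfK.
have taud a : tau a * d = - (th * (8 * a - X)) by rewrite dE -tauE; ring.
clearbody tau th; pose r := (Y + tau A%:~R * d) / 8 - A%:~R.
have [j [m [j02 close]]] := three_columns r th01.
pose a := A + j; exists a, m, (Num.floor (tau a%:~R)).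
set i := Num.floor _; have il := floor_le (tau a%:~R).
have ig := floorD1_gt (tau a%:~R).
rewrite -/i intrD in il ig.
have cross : -6 <= Y + tau a%:~R * d - 8 * (a%:~R + 3 * m%:~R) <= 6.
  have -> : Y + tau a%:~R * d - 8 * (a%:~R + 3 * m%:~R) =
            8 * (r - (1 + th) * j%:~R - 3 * m%:~R).
    rewrite /r !taud /a intrD; move: (_%:~R) (_%:~R) (_%:~R) => A' j' m'.
    by clear; field.
  by move: close; rewrite ler_norml; clear; lra.
have crossX := tauE a%:~R; clear close r taud tauE dE.
have aA : A <= a <= A + 2 by move: j02; rewrite /a; clear; lia.
move: (tau _) il ig cross crossX => T il ig cross crossX.
clearbody a i; clear j j02 tau th th01.
split=> //; first by rewrite -crossX ler_pM2r ?ltr_pM2r; lra.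
move=> n ni; have {ni} : -1 <= n%:~R - T <= 1.
  by case: ni => ->; rewrite ?intrD; lra.
rewrite !(intrD, intrM) !ler_norml; move: (n%:~R) (a%:~R) (m%:~R) crossX cross.
clear il ig i => n' a' m' crossX cross nT.
have ne : -1 <= (n' - T) * e <= 1 by nra.
have nd : -1 <= (n' - T) * d <= 1 by nra.
have ned : -1 <= (n' - T) * (e + d) <= 1 by nra.
by split; lra.
Qed.

(** The forms with coefficients (p, q) and (p', q') are two of the three forms
of [hexagon], up to a common sign, in such an order that lattice points and
tiles can be described through them. This lets [column_hit] serve all six
cases. *)
Definition hex_axes p q p' q' : Prop := forall a m : int, exists b t : int,
  [/\ (2 %| b - t)%Z, p * (8 * b%:~R) + q * (14 * t%:~R) = 8 * a%:~R &
   forall x y, `|(p * x + q * y) - 8 * a%:~R| <= 7 ->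
     `|(p' * x + q' * y) - 8 * (a + 3 * m)%:~R| <= 7 ->
     `|(p * x + q * y) + (p' * x + q' * y) - 8 * (2 * a + 3 * m)%:~R| <= 7 ->
     hexagon 7 (x - 8 * b%:~R) (y - 14 * t%:~R)].

Lemma hex_axes1 : hex_axes 1 0 (- (1 / 2)) (6 / 7).
Proof.
move=> a m; exists a, (a + 2 * m); split; first by lia.
  by ring.
move=> x y; rewrite /hexagon !(intrD, intrM) !ler_norml.
by move: (a%:~R) (m%:~R) => a' m'; clear => ? ? ?; split; lra.
Qed.

Lemma hex_axes2 : hex_axes (- (1 / 2)) (6 / 7) (- (1 / 2)) (- (6 / 7)).
Proof.
move=> a m; exists (- (2 * a + 3 * m)), (- m); split; first by lia.
  rewrite !(intrD, intrM, intrN).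
  by move: (a%:~R) (m%:~R) => a' m'; clear; field.
move=> x y; rewrite /hexagon !(intrD, intrM, intrN) !ler_norml.
by move: (a%:~R) (m%:~R) => a' m'; clear => ? ? ?; split; lra.
Qed.

Lemma hex_axes3 : hex_axes (- (1 / 2)) (- (6 / 7)) 1 0.
Proof.
move=> a m; exists (a + 3 * m), (- (a + m)); split; first by lia.
  rewrite !(intrD, intrM, intrN).
  by move: (a%:~R) (m%:~R) => a' m'; clear; field.
move=> x y; rewrite /hexagon !(intrD, intrM, intrN) !ler_norml.
by move: (a%:~R) (m%:~R) => a' m'; clear => ? ? ?; split; lra.
Qed.

Lemma hex_axesN p q p' q' :
  hex_axes p q p' q' -> hex_axes (- p) (- q) (- p') (- q').
Proof.
move=> ax a m; have [b [t [par cE hexE]]] := ax (- a) (- m).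
exists b, t; split=> //; first by move: cE; rewrite intrN; clear; lra.
move=> x y h1 h2 h3; apply: hexE; [move: h1|move: h2|move: h3];
  rewrite -normrN; congr (`|_| <= _); rewrite !(intrD, intrM, intrN);
  clear; ring.
Qed.

(** Two of three numbers with sum 0 have the same sign, and the square of the
third is at least half the sum of the squares; 32/25 is twice (4/5)^2. *)
Lemma dominant_coord (w w' w'' : R) : w + w' + w'' = 0 -> w <= 1 ->
  w' <= 0 -> w'' <= 0 -> 32 / 25 <= w ^+ 2 + w' ^+ 2 + w'' ^+ 2 ->
  4 / 5 <= w <= 1 /\ - w <= w' <= 0.
Proof. by move=> s0 w1 w'0 w''0 sq; split; [apply/andP; split; nra|lra]. Qed.

Lemma dominant_axis u v : u ^+ 2 + v ^+ 2 = 1 -> exists p q p' q',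
  [/\ hex_axes p q p' q', 4 / 5 <= p * u + q * v <= 1 &
      - (p * u + q * v) <= p' * u + q' * v <= 0].
Proof.
pose w2 u v := - (1 / 2) * u + 6 / 7 * v.
pose w3 u v := - (1 / 2) * u + - (6 / 7) * v.
(* The case where two forms are nonpositive; the other case is opposite. *)
have half x y : x ^+ 2 + y ^+ 2 = 1 ->
    [\/ w2 x y <= 0 /\ w3 x y <= 0, w3 x y <= 0 /\ x <= 0
      | x <= 0 /\ w2 x y <= 0] ->
    exists p q p' q', [/\ hex_axes p q p' q', 4 / 5 <= p * x + q * y <= 1 &
      - (p * x + q * y) <= p' * x + q' * y <= 0].
  move=> xy1; have [/andP[_ x1] _ xy2 xy3] := unit_forms xy1.
  have s0 : x + w2 x y + w3 x y = 0 by rewrite /w2 /w3; clear; field.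
  have sq : 32 / 25 <= x ^+ 2 + w2 x y ^+ 2 + w3 x y ^+ 2.
    by rewrite /w2 /w3; move: xy1; clear; nra.
  have w2_le1 : w2 x y <= 1 by rewrite /w2; move: xy3; clear; lra.
  have w3_le1 : w3 x y <= 1 by rewrite /w3; move: xy2; clear; lra.
  have xE : 1 * x + 0 * y = x by ring.
  clear xy1 xy2 xy3.
  case=> -[ha hb].
  - exists 1, 0, (- (1 / 2)), (6 / 7); rewrite xE -/(w2 x y).
    have [] := dominant_coord s0 x1 ha hb sq.
    by split=> //; apply: hex_axes1.
  - exists (- (1 / 2)), (6 / 7), (- (1 / 2)), (- (6 / 7)).
    rewrite -/(w2 x y) -/(w3 x y).
    have [||] := @dominant_coord (w2 x y) (w3 x y) x _ w2_le1 ha hb.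
    - by rewrite -s0; ring.
    - by move: sq; clear; lra.
    by split=> //; apply: hex_axes2.
  - exists (- (1 / 2)), (- (6 / 7)), 1, 0; rewrite xE -/(w3 x y).
    have [||] := @dominant_coord (w3 x y) x (w2 x y) _ w3_le1 ha hb.
    - by rewrite -s0; ring.
    - by move: sq; clear; lra.
    by split=> //; apply: hex_axes3.
move=> uv1.
have [|pos] : [\/ w2 u v <= 0 /\ w3 u v <= 0, w3 u v <= 0 /\ u <= 0
      | u <= 0 /\ w2 u v <= 0] \/
    [\/ w2 (- u) (- v) <= 0 /\ w3 (- u) (- v) <= 0,
        w3 (- u) (- v) <= 0 /\ - u <= 0 | - u <= 0 /\ w2 (- u) (- v) <= 0].
- have -> : w2 (- u) (- v) = - w2 u v by rewrite /w2; ring.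
  have -> : w3 (- u) (- v) = - w3 u v by rewrite /w3; ring.
  rewrite !oppr_le0.
  have [h1|/ltW h1] := lerP 0 u; have [h2|/ltW h2] := lerP 0 (w2 u v);
  have [h3|/ltW h3] := lerP 0 (w3 u v);
  first [by left; constructor 1 | by left; constructor 2
  | by left; constructor 3 | by right; constructor 1 | by right; constructor 2
  | by right; constructor 3].
- exact: half.
have [|p [q [p' [q' [ax e1 d1]]]]] := half (- u) (- v) _ pos.
  by rewrite !sqrrN.
exists (- p), (- q), (- p'), (- q'); split; first exact: hex_axesN.
  by rewrite !mulrN in e1; rewrite !mulNr.
by rewrite !mulrN in d1; rewrite !mulNr.
Qed.

Definition cell z : int := Num.floor (5 / 3 * z).

Lemma cell_itv z : 3 / 5 * (cell z)%:~R <= z < 3 / 5 * ((cell z)%:~R + 1).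
Proof.
have := floor_le (5 / 3 * z); have := floorD1_gt (5 / 3 * z).
by rewrite -/(cell z) intrD; clear; lra.
Qed.

Lemma cell_fat z z' : `|z' - z| <= 1 / 20 -> fat (cell z) z'.
Proof. by rewrite /fat ler_norml; have := cell_itv z; clear; lra. Qed.

(** The increase of the radius leaves room for (1/2 + 6/7) / 20 < 1/10. *)
Lemma hexagon_near x y x' y' : hexagon 7 x y ->
  `|x' - x| <= 1 / 20 -> `|y' - y| <= 1 / 20 -> hexagon (71 / 10) x' y'.
Proof.
rewrite /hexagon !ler_norml => -[h1 h2 h3] dx dy; split.
- by move: h1 dx; clear; lra.
- by move: h2 dx dy; clear; lra.
- by move: h3 dx dy; clear; lra.
Qed.

Lemma cell_step z w : -1 <= w <= 1 -> (3 %| cell (z + w) - cell z)%Z ->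
  -(3 / 5) <= w <= 3 / 5.
Proof.
move=> w1 dv; have := cell_itv z; have := cell_itv (z + w).
move: (cell z) (cell (z + w)) dv => k l dv zw_itv z_itv.
have [kl|neq] := eqVneq l k; first by subst l; clear -zw_itv z_itv; lra.
exfalso; have : (3 <= l - k) || (l - k <= -3).
  by move: dv neq; clear; lia.
by clear dv neq; case/orP; rewrite -(ler_int R) rmorphB /=; lra.
Qed.

(** A unit step has a coordinate larger than 3/5, which changes the cell; and it
moves by at most 2 cells, which is not enough to return to the same residue. *)
Lemma phase_step x y u v : u ^+ 2 + v ^+ 2 = 1 ->
  phase_of (cell (x + u)) (cell (y + v)) != phase_of (cell x) (cell y).
Proof.
move=> uv1; apply/negP; rewrite xpair_eqE !res_eq => /andP[dvx dvy].
have [u1 v1 _ _] := unit_forms uv1.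
move: (cell_step u1 dvx) (cell_step v1 dvy) uv1; clear => u35 v35 uv1.
have : u ^+ 2 <= 9 / 25 by clear uv1 v35; nra.
have : v ^+ 2 <= 9 / 25 by clear uv1 u35; nra.
by clear u35 v35; lra.
Qed.

(** [column_hit] with its conclusion transported to the plane, for columns ahead
of the starting point, so that the index of the term is a natural number. *)
Lemma hit_in_block x y u v p q p' q' (A : int) :
  hex_axes p q p' q' -> 4 / 5 <= p * u + q * v <= 1 ->
  - (p * u + q * v) <= p' * u + q' * v <= 0 ->
  p * x + q * y <= 8 * A%:~R ->
  exists a b t : int, exists i : nat,
  [/\ A <= a <= A + 2, p * (8 * b%:~R) + q * (14 * t%:~R) = 8 * a%:~R,
      (2 %| b - t)%Z, 4 / 5 * i%:R <= 8 * a%:~R - (p * x + q * y) &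
   forall n, n = i \/ n = i.+1 ->
     hexagon 7 (x + n%:R * u - 8 * b%:~R) (y + n%:R * v - 14 * t%:~R)].
Proof.
set X := p * x + q * y; set e := p * u + q * v; set d := p' * u + q' * v.
move=> ax e45 d01 XA.
have e01 : 0 < e <= 1 by clear -e45; lra.
have [a [m [i [aA itv near]]]] := column_hit X (p' * x + q' * y) A e01 d01.
have [b [t [par cE hexE]]] := ax a m.
have Aa : A%:~R <= a%:~R :> R by rewrite ler_int; case/andP: aA.
have i0 : 0 <= i.
  have : 0 < i%:~R + 1 :> R by clear -itv Aa XA e01; nra.
  rewrite -[1]/(1%:~R) -intrD ltr0z; clear; lia.
case: i i0 itv near => [i|//] _ itv near.
exists a, b, t, i; split=> //.
  have i0 : 0 <= i%:R :> R by [].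
  have [ie _] := andP itv; rewrite -pmulrn in ie.
  by clear -ie i0 e45; nra.
move=> n ni; have [|h1 h2 h3] := near n%:Z.
  by case: ni => ->; [left|right]; rewrite // -addn1 PoszD.
have eqX r r' : (r * (x + n%:R * u) + r' * (y + n%:R * v)) =
                (r * x + r' * y) + n%:~R * (r * u + r' * v).
  by rewrite -pmulrn; ring.
apply: hexE; rewrite ?eqX //.
by rewrite addrACA -mulrDr.
Qed.

(** At most 6300 unit steps cannot wrap around the period, which is 6400 in
one direction and 11200 in the other. *)
Lemma same_tile (b b' t t' : int) (n n' x y u v : R) :
  0 <= n <= 6300 -> 0 <= n' <= 6300 -> -1 <= u <= 1 -> -1 <= v <= 1 ->
  hexagon 7 (x + n * u - 8 * b%:~R) (y + n * v - 14 * t%:~R) ->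
  hexagon 7 (x + n' * u - 8 * b'%:~R) (y + n' * v - 14 * t'%:~R) ->
  tile_of b t = tile_of b' t' -> b = b' /\ t = t'.
Proof.
move=> n0 n'0 u1 v1; rewrite /hexagon !ler_norml => -[h1 h2 h3] [h1' h2' h3'].
have du : -6300 <= n * u - n' * u <= 6300.
  by rewrite -mulrBl; clear -n0 n'0 u1; nra.
have dv : -6300 <= n * v - n' * v <= 6300.
  by rewrite -mulrBl; clear -n0 n'0 v1; nra.
move=> /eqP; rewrite xpair_eqE !res_eq => /andP[dvb dvt].
have small (c c' : int) : (800 %| c - c')%Z ->
    -800 < ((c - c')%:~R : R) < 800 -> c = c'.
  move=> dvc lt_c; have [//|neq] := eqVneq c c'.
  exfalso; have : (800 <= c - c') || (c - c' <= -800).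
    by move: dvc neq; clear; lia.
  by clear -lt_c; case/orP; rewrite -(ler_int R); lra.
have hb : -800 < ((b - b')%:~R : R) < 800.
  by move: h1 h1' du; rewrite rmorphB; clear; lra.
have ht : -800 < ((t - t')%:~R : R) < 800.
  by move: h2 h3 h2' h3' dv; rewrite rmorphB; clear; lra.
by split; apply: small.
Qed.

(** Block j of three columns provides tile j. A unit step advances by at least
4/5 in the fastest direction, so that the 3 * 210 columns, of width 8, are
reached in 8 * 630 / (4/5) = 6300 steps. The blocks being disjoint, the tiles
are distinct. *)
Lemma robust_hits x y u v : u ^+ 2 + v ^+ 2 = 1 ->
  exists (g : 'I_210 -> 'I_800 * 'I_800) (w : 'I_210 -> {set 'I_3 * 'I_3}),
  [/\ injective g, forall j, #|w j| = 2%N &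
   forall x' y' u' v', (forall i, (i < 6330)%N ->
       `|x' + i%:R * u' - (x + i%:R * u)| <= 1 / 20 /\
       `|y' + i%:R * v' - (y + i%:R * v)| <= 1 / 20) ->
   forall f : phases,
     (exists j, f (g j) \in w j) ->
     exists2 i, (i < 6330)%N & red f (x' + i%:R * u') (y' + i%:R * v')].
Proof.
move=> uv1; have [p [q [p' [q' [ax e45 d01]]]]] := dominant_axis uv1.
have [u1 v1 _ _] := unit_forms uv1.
(* A is the first column whose middle is ahead of the starting point. *)
pose X := p * x + q * y; pose A := Num.floor (X / 8) + 1.
have [XA AX] : X <= 8 * A%:~R /\ 8 * A%:~R <= X + 8.
  have := floor_le (X / 8); have := floorD1_gt (X / 8).
  by rewrite -/A /A !intrD; clear; lra.
have /choice[F HF] : forall j : 'I_210, exists F : (int * int * int * nat)%type,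
    let: (a, b, t, i) := F in
    [/\ A + 3 * j%:Z <= a <= A + 3 * j%:Z + 2,
        p * (8 * b%:~R) + q * (14 * t%:~R) = 8 * a%:~R,
        (2 %| b - t)%Z, i%:R <= 6300 :> R &
     forall n, n = i \/ n = i.+1 ->
     hexagon 7 (x + n%:R * u - 8 * b%:~R) (y + n%:R * v - 14 * t%:~R)].
  move=> j; have XAj : X <= 8 * (A + 3 * j%:Z)%:~R.
    rewrite (le_trans XA)// ler_pM2l// ler_int; clear; lia.
  have [a [b [t [i [aA cE par iX near]]]]] := hit_in_block ax e45 d01 XAj.
  exists (a, b, t, i); split=> //.
  have : a%:~R <= (A + 629)%:~R :> R.
    by rewrite ler_int; move: (ltn_ord j) aA; clear; lia.
  by move: iX AX; rewrite intrD -/X; clear; lra.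
pose a j := (F j).1.1.1; pose b j := (F j).1.1.2; pose t j := (F j).1.2.
pose i j := (F j).2.
have {}HF (j : 'I_210) : [/\ A + 3 * j%:Z <= a j <= A + 3 * j%:Z + 2,
        p * (8 * (b j)%:~R) + q * (14 * (t j)%:~R) = 8 * (a j)%:~R,
        (2 %| b j - t j)%Z, (i j)%:R <= 6300 :> R &
     forall n, n = i j \/ n = (i j).+1 ->
     hexagon 7 (x + n%:R * u - 8 * (b j)%:~R) (y + n%:R * v - 14 * (t j)%:~R)].
  by have := HF j; rewrite /a /b /t /i; case: (F j) => -[[? ?] ?] ?.
clearbody a b t i; clear F.
pose ph n j := phase_of (cell (x + n%:R * u - 8 * (b j)%:~R))
                        (cell (y + n%:R * v - 14 * (t j)%:~R)).
exists (fun j => tile_of (b j) (t j)),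
  (fun j => [set ph (i j) j; ph (i j).+1 j]); split.
- move=> j j' eqt; have [aj cj _ ij hj] := HF j.
  have [aj' cj' _ ij' hj'] := HF j'.
  have [||eqb eqt'] := same_tile _ _ u1 v1 (hj _ (or_introl erefl))
                 (hj' _ (or_introl erefl)) eqt.
  - by rewrite ler0n.
  - by rewrite ler0n.
  have cjj' : 8 * (a j)%:~R = 8 * (a j')%:~R :> R by rewrite -cj -cj' eqb eqt'.
  have eqa : a j = a j'.
    by apply: (@intr_inj R); move: cjj'; clear; lra.
  by apply: val_inj; move: aj aj'; rewrite eqa /=; clear; lia.
- move=> j; rewrite cards2 eq_sym /ph -natr1.
  have -> : x + ((i j)%:R + 1) * u - 8 * (b j)%:~R =
            x + (i j)%:R * u - 8 * (b j)%:~R + u by ring.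
  have -> : y + ((i j)%:R + 1) * v - 14 * (t j)%:~R =
            y + (i j)%:R * v - 14 * (t j)%:~R + v by ring.
  by rewrite phase_step.
move=> x' y' u' v' near f [j].
have [_ _ par ij hj] := HF j.
have hit n : n = i j \/ n = (i j).+1 -> f (tile_of (b j) (t j)) = ph n j ->
    exists2 i, (i < 6330)%N & red f (x' + i%:R * u') (y' + i%:R * v').
  move=> ni fE.
  have n1 : n%:R <= (i j)%:R + 1 :> R.
    by case: ni => ->; [rewrite lerDl|rewrite natr1].
  have n6330 : (n < 6330)%N.
    have : n%:R < 6330 :> R by move: n1 ij; clear; lra.
    by rewrite ltr_nat.
  exists n => //; have [dx dy] := near n n6330.
  exists (b j), (t j), (cell (x + n%:R * u - 8 * (b j)%:~R)),
    (cell (y + n%:R * v - 14 * (t j)%:~R)).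
  have sub (r r' s : R) : r - s - (r' - s) = r - r' by clear; ring.
  split=> //.
  - by apply: hexagon_near (hj n ni) _ _; rewrite sub.
  - by apply: cell_fat; rewrite sub.
  - by apply: cell_fat; rewrite sub.
rewrite !inE => /orP[] /eqP fE; apply: hit fE; [by left|by right].
Qed.

(** * Choosing the phases *)

Lemma floor_key (n : nat) z : 0 <= z < n%:R ->
  exists k : 'I_n, k%:R <= z < k%:R + 1.
Proof.
case/andP=> z0 zn; have fl0 : 0 <= Num.floor z by rewrite floor_ge0.
have flz : `|Num.floor z|%N%:R = (Num.floor z)%:~R :> R.
  by rewrite pmulrn gez0_abs.
have ltn : (`|Num.floor z| < n)%N.
  by rewrite -(ltr_nat R) flz (le_lt_trans (floor_le z)).
exists (Ordinal ltn); rewrite /= flz floor_le.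
by have := floorD1_gt z; rewrite intrD.
Qed.

Lemma near_progression (x x' u u' d : R) (n : nat) : `|x' - x| <= d ->
  n%:R * `|u' - u| <= d ->
  forall i, (i < n)%N -> `|x' + i%:R * u' - (x + i%:R * u)| <= d + d.
Proof.
move=> dx du i /ltnW; rewrite -(ler_nat R) => i_n.
have -> : x' + i%:R * u' - (x + i%:R * u) = x' - x + i%:R * (u' - u) by ring.
rewrite (le_trans (ler_normD _ _))// lerD// normrM ger0_norm ?ler0n//.
by rewrite (le_trans _ du)// ler_wpM2r.
Qed.

(** Two progressions with the same rounded data differ by at most
1/40 + 6330 / 253200 = 1/20 throughout, so that [robust_hits], applied to one
progression for each possible value of the data, covers all of them. *)
Lemma exists_phases (n1 n2 n3 : nat) :
  n1%:R = 40 * 6400 :> R -> n2%:R = 40 * 11200 :> R ->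
  5064 * 100 < n3%:R :> R -> (n1 * n2 * (n3 * n3) * 7 ^ 210 < 9 ^ 210)%N ->
  exists f : phases, forall x y u v,
    0 <= x < 6400 -> 0 <= y < 11200 -> u ^+ 2 + v ^+ 2 = 1 ->
    exists2 i, (i < 6330)%N & red f (x + i%:R * u) (y + i%:R * v).
Proof.
move=> n1E n2E n3E few.
pose key (e : 'I_n1 * 'I_n2 * ('I_n3 * 'I_n3)) x y u v :=
  [/\ e.1.1%:R <= 40 * x < e.1.1%:R + 1, e.1.2%:R <= 40 * y < e.1.2%:R + 1,
      e.2.1%:R <= 2532 * 100 * (u + 1) < e.2.1%:R + 1 &
      e.2.2%:R <= 2532 * 100 * (v + 1) < e.2.2%:R + 1].
pose P e (f : phases) := forall x y u v,
  u ^+ 2 + v ^+ 2 = 1 -> key e x y u v ->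
  exists2 i, (i < 6330)%N & red f (x + i%:R * u) (y + i%:R * v).
have card_phase : #|{: 'I_3 * 'I_3}| = 9%N by rewrite card_prod !card_ord.
have [|e||f Pf] := @union_bound _ _ _ 210 2 P; rewrite ?card_phase//.
- have [[x [y [u [v [uv1 key_e]]]]]|none] := EM (exists x y u v,
      u ^+ 2 + v ^+ 2 = 1 /\ key e x y u v); last first.
    exists finset.set0; rewrite cards0 mul0n leq0n; split=> //.
    move=> f _ x y u v uv1 key_e.
    by case: none; exists x, y, u, v.
  have [g [w [injg cardw hits]]] := robust_hits x y uv1.
  exists [set f : phases | [forall j, f (g j) \notin w j]]; split.
    by have := card_avoid injg cardw; rewrite card_phase => ->.
  move=> f; rewrite inE negb_forall => /existsP[j]; rewrite negbK => fj.
  move=> x' y' u' v' _ key_e'; apply: hits; last by exists j.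
  move: key_e key_e' => [kx ky ku kv] [kx' ky' ku' kv'] i i_lt.
  have -> : 1 / 20 = 1 / 40 + 1 / 40 :> R by clear; field.
  split; apply: near_progression i_lt.
  + by rewrite ler_norml; clear -kx kx'; lra.
  + suff : `|u' - u| <= 1 / (2532 * 100) by move: (`|_|) => z; clear; lra.
    by rewrite ler_norml; clear -ku ku'; lra.
  + by rewrite ler_norml; clear -ky ky'; lra.
  + suff : `|v' - v| <= 1 / (2532 * 100) by move: (`|_|) => z; clear; lra.
    by rewrite ler_norml; clear -kv kv'; lra.
- by rewrite !card_prod !card_ord.
exists f => x y u v x0 y0 uv1; have [u1 v1 _ _] := unit_forms uv1.
have [|kx kxE] := @floor_key n1 (40 * x); first by rewrite n1E; clear -x0; lra.
have [|ky kyE] := @floor_key n2 (40 * y); first by rewrite n2E; clear -y0; lra.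
have [|ku kuE] := @floor_key n3 (2532 * 100 * (u + 1)).
  by move: n3E u1; clear; lra.
have [|kv kvE] := @floor_key n3 (2532 * 100 * (v + 1)).
  by move: n3E v1; clear; lra.
by apply: (Pf (kx, ky, (ku, kv))).
Qed.

(** The factors bound the numbers of roundings to 1/40 of a starting point in
[0, 6400) x [0, 11200) and to 1/253200 of the two coordinates, in [-1, 1], of
a step. Their product is about 2^74.6, and (9/7)^210 is about 2^76.1. The
comparison is done on binary integers. *)
Lemma keys_lt_pow : (256 * 1000 * (448 * 1000) * (507 * 1000 * (507 * 1000)) *
  7 ^ 210 < 9 ^ 210)%N.
Proof.
have expZ a b : BinInt.Z.of_nat (a ^ b)%N =
    BinInt.Z.pow (BinInt.Z.of_nat a) (BinInt.Z.of_nat b).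
  elim: b => // b IHb.
  by rewrite expnS Znat.Nat2Z.inj_succ BinInt.Z.pow_succ_r; lia.
have ltZ a b c m p q k :
    (let z := BinInt.Z.of_nat in let mul := BinInt.Z.mul in
     BinInt.Z.ltb (mul (mul (mul (mul (z a) (z m)) (mul (z b) (z m)))
       (mul (mul (z c) (z m)) (mul (z c) (z m)))) (BinInt.Z.pow (z p) (z k)))
       (BinInt.Z.pow (z q) (z k))) = true ->
    (a * m * (b * m) * (c * m * (c * m)) * p ^ k < q ^ k)%N.
  move=> /=; rewrite -!expZ => /BinInt.Z.ltb_lt.
  move: (p ^ k)%N (q ^ k)%N => P Q.
  by rewrite -!Znat.Nat2Z.inj_mul => /Znat.Nat2Z.inj_lt/ssrnat.ltP.
by apply: ltZ; vm_compute.
Qed.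

Lemma exists_hitting_phases :
  exists f : phases, forall x y u v,
    u ^+ 2 + v ^+ 2 = 1 ->
    exists2 i, (i < 6330)%N & red f (x + i%:R * u) (y + i%:R * v).
Proof.
have n1E : (256 * 1000)%N%:R = 40 * 6400 :> R by rewrite natrM; ring.
have n2E : (448 * 1000)%N%:R = 40 * 11200 :> R by rewrite natrM; ring.
have n3E : 5064 * 100 < (507 * 1000)%N%:R :> R.
  by rewrite natrM; clear; lra.
have [f Hf] := exists_phases n1E n2E n3E keys_lt_pow.
exists f => x y u v uv1; clear n1E n2E n3E.
have period z (T : R) : 0 < T -> exists k : int, 0 <= z - T * k%:~R < T.
  move=> T0; exists (Num.floor (z / T)).
  have := floor_le (z / T); have := floorD1_gt (z / T).
  rewrite ler_pdivlMr// ltr_pdivrMr// intrD.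
  by move: (_%:~R) => r; clear; lra.
have [k xk] := period x 6400 ltac:(by []).
have [l yl] := period y 11200 ltac:(by []).
have [i i_lt hit] := Hf _ _ _ _ xk yl uv1.
exists i; [exact: i_lt|].
have addK z w r : z - w + r + w = z + r :> R by clear; ring.
by have := red_shift k l hit; rewrite !addK.
Qed.

(** Equality case of the triangle inequality: a point at distance n from the
origin and n - 1 from a unit vector is n times that vector. *)
Lemma unit_steps_collinear (u v w z : R) (n : R) :
  u ^+ 2 + v ^+ 2 = 1 -> w ^+ 2 + z ^+ 2 = n ^+ 2 ->
  (w - u) ^+ 2 + (z - v) ^+ 2 = (n - 1) ^+ 2 -> w = n * u /\ z = n * v.
Proof.
move=> uv1 wz wuzv.
have : (w - n * u) ^+ 2 + (z - n * v) ^+ 2 = 0.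
  have wu : w * u + z * v = n.
    by move: uv1 wz wuzv; clear; nra.
  have -> : (w - n * u) ^+ 2 + (z - n * v) ^+ 2 = w ^+ 2 + z ^+ 2
     - 2 * n * (w * u + z * v) + n ^+ 2 * (u ^+ 2 + v ^+ 2) by ring.
  by rewrite wz wu uv1; ring.
move/eqP; rewrite paddr_eq0 ?sqr_ge0// !sqrf_eq0 !subr_eq0.
by case/andP=> /eqP-> /eqP->.
Qed.

End Pattern.

(** * Congruent copies of a line of points *)

Lemma edist_sqr (R : realType) (p q : 'rV[R]_2) :
  (p 0 0 - q 0 0) ^+ 2 + (p 0 1 - q 0 1) ^+ 2 = edist p q ^+ 2.
Proof.
rewrite /edist sqr_sqrtr; last by apply: sumr_ge0 => i _; apply: sqr_ge0.
rewrite big_ord_recl big_ord1; congr (_ + (p 0 _ - q 0 _) ^+ 2).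
all: by apply: val_inj.
Qed.

Lemma edist_axis (R : realType) (i j : nat) :
  edist (i%:R *: delta_mx 0 ord0 : 'rV[R]_2) (j%:R *: delta_mx 0 ord0) ^+ 2 =
  (i%:R - j%:R) ^+ 2.
Proof. by rewrite -edist_sqr !mxE /=; ring. Qed.

Theorem theorem1p2 (R : realType) :
  @not_arrow R 2 (@ell R 1 2) (@ell R 1 6330).
Proof.
have [f hit] := exists_hitting_phases R.
pose c (p : 'rV[R]_2) := if pselect (red f (p 0 0) (p 0 1)) then Red else Blue.
exists c; split=> T [h iso_h ->] mono; pose P i := h (i%:R *: delta_mx 0 ord0).
  have redP i : (i < 2)%N -> red f (P i 0 0) (P i 0 1).
    move=> i2; have : c (P i) = Red.
      by apply: mono; exists (i%:R *: delta_mx 0 ord0) => //; exists i.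
    by rewrite /c; case: pselect.
  apply: (red_no_unit (redP 0 isT) (redP 1 isT)).
  by rewrite edist_sqr iso_h edist_axis; ring.
have dP i j : edist (P i) (P j) ^+ 2 = (i%:R - j%:R) ^+ 2.
  by rewrite iso_h edist_axis.
pose u := P 1%N 0 0 - P 0%N 0 0; pose v := P 1%N 0 1 - P 0%N 0 1.
have uv1 : u ^+ 2 + v ^+ 2 = 1 by rewrite edist_sqr dP; ring.
have [i i_lt] := hit (P 0%N 0 0) (P 0%N 0 1) u v uv1.
have [||wE zE] := @unit_steps_collinear R u v (P i 0 0 - P 0%N 0 0)
  (P i 0 1 - P 0%N 0 1) i%:R uv1.
- by rewrite edist_sqr dP subr0.
- have -> : P i 0 0 - P 0%N 0 0 - u = P i 0 0 - P 1%N 0 0 by rewrite /u; ring.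
  have -> : P i 0 1 - P 0%N 0 1 - v = P i 0 1 - P 1%N 0 1 by rewrite /v; ring.
  by rewrite edist_sqr dP.
rewrite -wE -zE !subrKC => red_i.
have : c (P i) = Blue.
  by apply: mono; exists (i%:R *: delta_mx 0 ord0) => //; exists i.
by rewrite /c; case: pselect.
Qed.
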